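(* Let $h>0$ and let $B\subset\mathbb Z^8_h$ be bounded. Then for every function $f:\overline B\to\mathbb O$ and every $y\in\mathbb Z^8_h$, $$\chi_B(y)f(y)=\int_{\partial B}K^h(x,y)*f(x)\,dS(x)+\int_BE^h(y-x)\,(D^hf)(x)\,dV^h(x).$$
   Context: $\mathbb O$ is the real octonion algebra with basis $\mathbf e_0=1,\mathbf e_1,\dots,\mathbf e_7$, where $\mathbf e_i\mathbf e_j=-\delta_{ij}+\sum_k\varepsilon_{ijk}\mathbf e_k$ for $1\le i,j\le 7$, $\varepsilon_{ijk}$ totally antisymmetric with $\varepsilon_{ijk}=1$ for $ijk\in\{123,145,176,246,257,347,365\}$; $\overline{\mathbf e}_0=\mathbf e_0$, $\overline{\mathbf e}_l=-\mathbf e_l$ ($l\ge1$). For $h>0$, $\mathbb Z^8_h=(h\mathbb Z)^8$, $e_0,\dots,e_7$ are the standard unit vectors of $\mathbb R^8$, $\chi_A$ is the indicator of $A$. Difference operators: $\partial_l^{+,h}f(x)=(f(x+he_l)-f(x))/h$, $\partial_l^{-,h}f(x)=(f(x)-f(x-he_l))/h$, $\partial_l^h=\frac12(\partial_l^{+,h}+\partial_l^{-,h})$, $D^hf=\sum_{l=0}^7\mathbf e_l\partial_l^hf$. $N(x)=\{x,x\pm he_0,\dots,x\pm he_7\}$; $\partial B=\{x:\ N(x)\cap B\neq\emptyset,\ N(x)\cap(\mathbb Z^8_h\setminus B)\neq\emptyset\}$, $\overline B=B\cup\partial B$. $\int_Ag\,dV^h=\sum_{x\in A}g(x)h^8$.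 For $x\in\partial B$: $\Sigma(x)=\sum_l[(\partial_l^{+,h}\chi_B(x))^2+(\partial_l^{-,h}\chi_B(x))^2]$, $s(x)=\frac{h^8}{2}\sqrt{\Sigma(x)}$, $n_l^\pm(x)=-2\partial_l^{\pm,h}\chi_B(x)/\sqrt{\Sigma(x)}$, and $\int_{\partial B}g\,dS=\sum_{x\in\partial B}g(x)s(x)$. Fundamental solution: $E^1(x)=\frac{1}{(2\pi)^8}\int_{[-\pi,\pi]^8}\frac{\sum_l\overline{\mathbf e}_l\sin u_l}{\sum_l\sin^2u_l}\sin(\sum_lu_lx_l)\,du$ for $x\in\mathbb Z^8$, and $E^h(x)=h^{-7}E^1(x/h)$ for $x\in\mathbb Z^8_h$. Star product with the boundary kernel: for $x\in\partial B$, $y\in\mathbb Z^8_h$ and $g:\partial B\to\mathbb O$, $$K^h(x,y)*g(x)=-\frac12\sum_{l=0}^7\Big(E^h(he_l-x+y)\,n_l^-(x)+E^h(-he_l-x+y)\,n_l^+(x)\Big)\big(\mathbf e_l\,g(x)\big).$$ *)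

(* Defs.v *)
From HB Require Import structures.
From mathcomp Require Import all_boot all_order all_algebra.
From mathcomp Require Import all_classical all_reals all_analysis.
Set Implicit Arguments. Unset Strict Implicit. Unset Printing Implicit Defensive.
Import Order.TTheory GRing.Theory Num.Theory.
Import numFieldNormedType.Exports.
Local Open Scope classical_set_scope.
Local Open Scope ring_scope.

Definition oct (R : realType) := 'rV[R]_8.

(** Lattice points of Z^8_h are represented by their integer index vector k;
    the actual point is h * k. *)
Definition pt := 'rV[int]_8.

Definition obasis (R : realType) (l : 'I_8) : oct R := \row_m ((m == l)%:R).
Definition ptbasis (l : 'I_8) : pt := \row_m ((m == l)%:R).

Definition fano : seq (nat * nat * nat) :=
  [:: (1,2,3); (1,4,5); (1,7,6); (2,4,6); (2,5,7); (3,4,7); (3,6,5)]%N.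
Definition eps (i j k : nat) : int :=
  if has (fun t => [|| t == (i,j,k), t == (j,k,i) | t == (k,i,j)]) fano then 1
  else if has (fun t => [|| t == (j,i,k), t == (i,k,j) | t == (k,j,i)]) fano then -1
  else 0.

Definition bmul (R : realType) (i j : 'I_8) : oct R :=
  if nat_of_ord i == 0%N then obasis R j
  else if nat_of_ord j == 0%N then obasis R i
  else (- (i == j)%:R) *: obasis R ord0
       + \sum_(k < 8) (eps i j k)%:~R *: obasis R k.

Definition omul (R : realType) (a b : oct R) : oct R :=
  \sum_(i < 8) \sum_(j < 8) (a ord0 i * b ord0 j) *: bmul R i j.

Definition oconj (R : realType) (a : oct R) : oct R :=
  \row_l (if nat_of_ord l == 0%N then a ord0 l else - a ord0 l).

Definition nbhd (k : pt) : set pt :=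
  [set z | z = k \/ exists l, z = k + ptbasis l \/ z = k - ptbasis l].
Definition bdry (B : set pt) : set pt :=
  [set x | (exists2 z, nbhd x z & B z) /\ (exists2 z, nbhd x z & ~ B z)].

Definition dchiP (R : realType) (h : R) (B : set pt) (l : 'I_8) (k : pt) : R :=
  (\1_B (k + ptbasis l) - \1_B k) / h.
Definition dchiM (R : realType) (h : R) (B : set pt) (l : 'I_8) (k : pt) : R :=
  (\1_B k - \1_B (k - ptbasis l)) / h.

Definition Sigma (R : realType) (h : R) (B : set pt) (k : pt) : R :=
  \sum_(l < 8) (dchiP h B l k ^+ 2 + dchiM h B l k ^+ 2).
Definition sdS (R : realType) (h : R) (B : set pt) (k : pt) : R :=
  h ^+ 8 / 2 * Num.sqrt (Sigma h B k).
Definition nP (R : realType) (h : R) (B : set pt) (l : 'I_8) (k : pt) : R :=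
  - 2 * dchiP h B l k / Num.sqrt (Sigma h B k).
Definition nM (R : realType) (h : R) (B : set pt) (l : 'I_8) (k : pt) : R :=
  - 2 * dchiM h B l k / Num.sqrt (Sigma h B k).

Definition Dh (R : realType) (h : R) (f : pt -> oct R) (k : pt) : oct R :=
  \sum_(l < 8) omul (obasis R l)
     (2^-1 *: (h^-1 *: (f (k + ptbasis l) - f k) + h^-1 *: (f k - f (k - ptbasis l)))).

Fixpoint iterint (R : realType) (n : nat) (F : seq R -> R) : R :=
  match n with
  | 0%N => F [::]
  | n'.+1 => \int[@lebesgue_measure R]_(t in `[(- pi)%R, pi]%classic)
               iterint n' (fun s => F (t :: s))
  end.

Definition E1integrand (R : realType) (m : pt) (u : 'I_8 -> R) : oct R :=
  ((\sum_(l < 8) sin (u l) ^+ 2)^-1 * sin (\sum_(l < 8) u l * (m ord0 l)%:~R))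
    *: (\sum_(l < 8) sin (u l) *: oconj (obasis R l)).

Definition E1 (R : realType) (m : pt) : oct R :=
  \row_c ((2 * pi) ^- 8 *
          iterint 8 (fun s => E1integrand m (fun i : 'I_8 => nth 0 s i) ord0 c)).

Definition Eh (R : realType) (h : R) (m : pt) : oct R := h ^- 7 *: E1 R m.

Definition Kstar (R : realType) (h : R) (B : set pt) (x y : pt) (g : pt -> oct R) : oct R :=
  (- 2^-1) *: \sum_(l < 8)
     omul (nM h B l x *: Eh h (ptbasis l - x + y) + nP h B l x *: Eh h (- ptbasis l - x + y))
          (omul (obasis R l) (g x)).

(* Main.v *)
Require Import Defs.
From HB Require Import structures.
From mathcomp Require Import all_boot all_order all_algebra.
From mathcomp Require Import all_classical all_reals all_analysis.
From mathcomp Require Import measurable_realfun ring lra.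
Import Order.TTheory GRing.Theory Num.Theory.
Import numFieldNormedType.Exports.
Local Open Scope classical_set_scope.
Local Open Scope ring_scope.

(** The symbol of each difference quotient of [E1] in direction [e_l] has
    coefficients [sin u_c * sin u_l * cos (u.m) / sum sin^2], symmetric in [c]
    and [l] with trace [cos (u.m)]. By the polarised alternative law
    [conj e_c (e_l g) + conj e_l (e_c g) = 2 delta_cl g], the sum over [l] of
    the products of these quotients with [e_l g] collapses to the trace part,
    that is, to the Fourier coefficient [delta_{m,0}] of [cos (u.m)] times [g],
    although the product is not associative. The formula is then summation by
    parts. All integrands are bounded, because
    [|sin (u.m)| <= sum |m_l| |sin u_l|] for integer [m], so the iterated
    integrals are linear and do not see the zeros of the denominator. *)

(** * Iterated integrals *)

(** Tonelli's measurability of partial integrals concerns nonnegative integrands, so [g] times the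
    indicator of [D] is split into positive and negative parts. *)
Lemma Rintegral_measurable (R : realType) d (T : measurableType d)
    (D : set R) (g : T * R -> R) : measurable D -> measurable_fun setT g ->
  measurable_fun setT
    (fun p => \int[@lebesgue_measure R]_(t in D) g (p, t)).
Proof.
move=> mD mg.
pose G (p : T) : \bar R := (\int[@lebesgue_measure R]_(t in D) (g (p, t))%:E)%E.
suff mG : measurable_fun setT G.
  have := @measurableT_comp _ _ _ _ _ _ _ _ _ (@fine_measurable R setT measurableT) mG.
  exact.
rewrite /G.
pose k (q : T * R) : \bar R := ((g q)%:E * (\1_D q.2)%:E)%E.
have mk : measurable_fun setT k.
  apply: emeasurable_funM; first exact/measurable_EFinP.
  apply/measurable_EFinP.
  by apply: (measurableT_comp _ measurable_snd); exact/measurable_indicP.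
have -> : (fun p => \int[@lebesgue_measure R]_(t in D) (g (p, t))%:E)%E =
  (fun p => \int[@lebesgue_measure R]_t (k^\+ (p, t)) -
            \int[@lebesgue_measure R]_t (k^\- (p, t)))%E.
  apply/funext => p; rewrite integral_mkcond integralE.
  have e : (fun t => (g (p, t))%:E) \_ D = (fun t => k (p, t)).
    apply/funext => t; rewrite /k patchE indicE /=.
    by case: (t \in D); rewrite ?mule1 ?mule0.
  by rewrite e; congr (_ - _)%E; apply: eq_integral => t _; rewrite ?funeposE ?funenegE.
apply: emeasurable_funB.
  apply: (@measurable_fun_fubini_tonelli_F _ _ T (measurableTypeR R) R lebesgue_measure (k^\+)%E).
    exact: measurable_funepos.
  by move=> x; exact: funepos_ge0.
apply: (@measurable_fun_fubini_tonelli_F _ _ T (measurableTypeR R) R lebesgue_measure (k^\-)%E).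
  exact: measurable_funeneg.
by move=> x; exact: funeneg_ge0.
Qed.

(* Joint measurability in the first [n] entries, tested by substituting
   arbitrary measurable functions so that it makes sense on [seq R]. *)
Definition measurable_seq (R : realType) (n : nat) (F : seq R -> R) :=
  forall d (T : measurableType d) (c : T -> seq R),
    (forall p, size (c p) = n) ->
    (forall i, measurable_fun setT (fun p => nth 0 (c p) i)) ->
    measurable_fun setT (F \o c).

(** Induction on the number [m] of inner integrals: the outermost of them turns into one more
    parameter appended to the prefix, whence the general [n]. *)
Lemma measurable_seq_iterint (R : realType) n m (F : seq R -> R) :
  measurable_seq R (n + m) F ->
  measurable_seq R n (fun s => iterint m (fun s' => F (s ++ s'))).
Proof.
elim: m n F => [|m IH] n F mF d T c sc mc.
  have := mF d T c; rewrite addn0 => /(_ sc mc); congr measurable_fun.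
  by apply/funext => p /=; rewrite cats0.
have := IH n.+1 F; rewrite addSnnS => /(_ mF) {}IH.
have sc' (q : T * R) : size (rcons (c q.1) q.2) = n.+1 by rewrite size_rcons sc.
(* Entries before [n] come from the prefix, entry [n] is the new variable, and later ones are the
   default 0. *)
have mc' i : measurable_fun setT (fun q : T * R => nth 0 (rcons (c q.1) q.2) i).
  have [lin|] := ltnP i n.
    have -> : (fun q : T * R => nth 0 (rcons (c q.1) q.2) i) =
              (fun p => nth 0 (c p) i) \o fst.
      by apply/funext => q /=; rewrite nth_rcons sc lin.
    by apply: measurableT_comp => //; exact: measurable_fst.
  rewrite leq_eqVlt => /orP[/eqP <-|nli].
    have -> : (fun q : T * R => nth 0 (rcons (c q.1) q.2) n) = snd.
      by apply/funext => q /=; rewrite nth_rcons sc ltnn eqxx.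
    exact: measurable_snd.
  have -> : (fun q : T * R => nth 0 (rcons (c q.1) q.2) i) = cst 0.
    apply/funext => q /=.
    by rewrite nth_rcons sc ltnNge (ltnW nli) /= (gtn_eqF nli).
  exact: measurable_cst.
have mG := IH _ _ _ sc' mc'.
have := @Rintegral_measurable R _ T `[- pi, pi]%classic _ _ mG.
move=> /(_ (measurable_itv _)); congr measurable_fun.
apply/funext => p /=; congr Rintegral; apply/funext => t.
by congr iterint; apply/funext => s'; rewrite cat_rcons.
Qed.

(** A class of integrands on which [iterint] is linear. The bound is uniform over lists of every
    length, so it passes to the slices [F (t :: s)] as it stands. *)
Definition tame_seq (R : realType) (n : nat) (F : seq R -> R) :=
  measurable_seq R n F /\ exists C, forall s, `|F s| <= C.

Lemma measurable_seq_cons (R : realType) n (F : seq R -> R) t :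
  measurable_seq R n.+1 F -> measurable_seq R n (fun s => F (t :: s)).
Proof.
move=> mF d T c sc mc; apply: (mF d T (fun p => t :: c p)).
  by move=> p /=; rewrite sc.
by case=> [|i] /=; [exact: measurable_cst | exact: mc].
Qed.

Lemma tame_seq_cons (R : realType) n (F : seq R -> R) t :
  tame_seq R n.+1 F -> tame_seq R n (fun s => F (t :: s)).
Proof.
by case=> mF [C FC]; split; [exact: measurable_seq_cons | exists C => s].
Qed.

Lemma measurable_iterint_cons (R : realType) n (F : seq R -> R) :
  measurable_seq R n.+1 F ->
  measurable_fun setT (fun t => iterint n (fun s => F (t :: s))).
Proof.
move=> mF; have := @measurable_seq_iterint R 1 n F mF.
move=> /(_ _ R (fun t => [:: t]) (fun=> erefl)); apply.
by case=> [|i] /=; [exact: measurable_id | rewrite nth_nil; exact: measurable_cst].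
Qed.

Lemma lebesgue_measure_pi (R : realType) :
  @lebesgue_measure R `[- pi, pi]%classic = (2 * pi : R)%:E.
Proof.
rewrite lebesgue_measure_itv /= lte_fin gtrN ?pi_gt0//.
by rewrite -EFinD; congr EFin; ring.
Qed.

Lemma bounded_measurable_integrable (R : realType) (f : R -> R) (C : R) :
  measurable_fun setT f -> (forall x, `|f x| <= C) ->
  (@lebesgue_measure R).-integrable `[- pi, pi]%classic (EFin \o f).
Proof.
move=> mf fC; apply: measurable_bounded_integrable => //.
- by have := ltry (2 * pi : R); rewrite -(lebesgue_measure_pi R).
- exact: measurable_funTS.
- exists C; split; first exact: num_real.
  by move=> M CM x _ /=; rewrite (le_trans (fC x))// ltW.
Qed.

(** Supplies, at each level of iteration, the boundedness that makes the inner integral integrable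
    in the next variable. *)
Lemma iterint_bound (R : realType) n (F : seq R -> R) C :
  measurable_seq R n F -> (forall s, `|F s| <= C) ->
  `|iterint n F| <= C * (2 * pi) ^+ n.
Proof.
elim: n F => [|n IH] F mF FC; first by rewrite /= expr0 mulr1.
have b t : `|iterint n (fun s => F (t :: s))| <= C * (2 * pi) ^+ n.
  by apply: IH => //; exact: measurable_seq_cons.
have mG := measurable_iterint_cons _ _ _ mF.
have iG := bounded_measurable_integrable _ _ _ mG b.
have := @le_normr_Rintegral _ (measurableTypeR R) R lebesgue_measure
  `[- pi, pi]%classic _ (measurable_itv _) iG.
move=> /le_trans; apply.
have -> : C * (2 * pi) ^+ n.+1 =
    \int[@lebesgue_measure R]_(t in `[- pi, pi]%classic) (C * (2 * pi) ^+ n).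
  by rewrite Rintegral_cst//= lebesgue_measure_pi /= exprS; ring.
apply: le_Rintegral => //.
- apply: (bounded_measurable_integrable _ _ (C * (2 * pi) ^+ n)).
    exact: measurableT_comp.
  by move=> x; rewrite normr_id.
- apply: (bounded_measurable_integrable _ _ `|C * (2 * pi) ^+ n|) => //.
Qed.

Lemma integrable_iterint_cons (R : realType) n (F : seq R -> R) :
  tame_seq R n.+1 F ->
  (@lebesgue_measure R).-integrable `[- pi, pi]%classic
    (EFin \o (fun t => iterint n (fun s => F (t :: s)))).
Proof.
move=> [mF [C FC]].
apply: (bounded_measurable_integrable _ _ (C * (2 * pi) ^+ n)).
  exact: measurable_iterint_cons.
by move=> t; apply: iterint_bound => //; exact: measurable_seq_cons.
Qed.

Lemma tame_seqD (R : realType) n (F G : seq R -> R) :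
  tame_seq R n F -> tame_seq R n G -> tame_seq R n (fun s => F s + G s).
Proof.
move=> [mF [C FC]] [mG [D GD]]; split.
  by move=> d T c sc mc; apply: measurable_funD; [exact: mF | exact: mG].
by exists (C + D) => s; rewrite (le_trans (ler_normD _ _))// lerD.
Qed.

Lemma tame_seqZ (R : realType) n (F : seq R -> R) a :
  tame_seq R n F -> tame_seq R n (fun s => a * F s).
Proof.
move=> [mF [C FC]]; split.
  move=> d T c sc mc; apply: measurable_funM; [exact: measurable_cst | exact: mF].
by exists (`|a| * C) => s; rewrite normrM ler_wpM2l.
Qed.

Lemma tame_seq0 (R : realType) n : tame_seq R n (fun=> 0).
Proof. by split; [move=> d T c _ _; exact: measurable_cst | exists 0 => s; rewrite normr0]. Qed.

Lemma tame_seq_sum (R : realType) n (I : Type) (r : seq I) (F : I -> seq R -> R) :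
  (forall i, tame_seq R n (F i)) -> tame_seq R n (fun s => \sum_(i <- r) F i s).
Proof.
move=> tF; elim: r => [|i r IH].
  by under [X in tame_seq _ _ X]eq_fun do rewrite big_nil; exact: tame_seq0.
by under [X in tame_seq _ _ X]eq_fun do rewrite big_cons; exact: tame_seqD.
Qed.

Lemma iterintD (R : realType) n (F G : seq R -> R) :
  tame_seq R n F -> tame_seq R n G ->
  iterint n (fun s => F s + G s) = iterint n F + iterint n G.
Proof.
elim: n F G => [//|n IH] F G tF tG /=.
rewrite -RintegralD//; [|exact: integrable_iterint_cons..].
apply: eq_Rintegral => t _.
by apply: (IH (fun s => F (t :: s)) (fun s => G (t :: s))); exact: tame_seq_cons.
Qed.

Lemma iterintZ (R : realType) n (F : seq R -> R) a :
  tame_seq R n F -> iterint n (fun s => a * F s) = a * iterint n F.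
Proof.
elim: n F => [//|n IH] F tF /=.
rewrite -RintegralZl//; last exact: integrable_iterint_cons.
apply: eq_Rintegral => t _.
by apply: (IH (fun s => F (t :: s))); exact: tame_seq_cons.
Qed.

Lemma iterint_sum (R : realType) n (I : Type) (r : seq I) (F : I -> seq R -> R) :
  (forall i, tame_seq R n (F i)) ->
  iterint n (fun s => \sum_(i <- r) F i s) = \sum_(i <- r) iterint n (F i).
Proof.
move=> tF; elim: r => [|i r IH].
  (* The integral of the zero function vanishes by homogeneity with factor 0. *)
  rewrite big_nil -[RHS](mul0r (iterint n (fun=> 0))) -iterintZ; last exact: tame_seq0.
  by congr iterint; apply/funext => s; rewrite big_nil mul0r.
rewrite big_cons -IH -iterintD//; last exact: tame_seq_sum.
by congr iterint; apply/funext => s; rewrite big_cons.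
Qed.

Lemma sin_eq0_pi (R : realType) (t : R) :
  - pi <= t <= pi -> sin t = 0 -> t \in [:: - pi; 0; pi].
Proof.
move=> /andP[t1 t2] s0; rewrite !inE; apply/or3P.
have [t0|t0|->] := ltgtP t 0; last by apply: Or32.
  move: t1; rewrite le_eqVlt eq_sym => /orP[->|t1]; first exact: Or31.
  have := @sin_gt0_pi R (- t); rewrite sinN s0 oppr0 ltxx => H.
  by exfalso; apply/notF/H; rewrite oppr_gt0 t0 ltrNl.
move: t2; rewrite le_eqVlt => /orP[->|t2]; first exact: Or33.
have := @sin_gt0_pi R t; rewrite s0 ltxx => H.
by exfalso; apply/notF/H; rewrite t0.
Qed.

(** Only the outermost variable needs an almost-everywhere argument: [sin] has three zeros on the
    interval, and for any other [t] the inner integrands are equal as functions. *)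
Lemma iterint_eq_off_sin0 (R : realType) n (F G : seq R -> R) :
  tame_seq R n.+1 F -> tame_seq R n.+1 G ->
  (forall t s, sin t != 0 -> F (t :: s) = G (t :: s)) ->
  iterint n.+1 F = iterint n.+1 G.
Proof.
move=> tF tG FG /=; congr fine; apply: ae_eq_integral => //.
- exact: measurable_int (integrable_iterint_cons _ _ _ tF).
- exact: measurable_int (integrable_iterint_cons _ _ _ tG).
have cD : countable [set` [:: - pi; 0; pi : R]].
  exact/finite_set_countable/finite_seq.
exists [set` [:: - pi; 0; pi : R]]; split.
- by apply: countable_measurable => // t; exact: measurable_set1.
- exact: countable_lebesgue_measure0.
move=> t /= /not_implyP[]; rewrite in_itv /= => /sin_eq0_pi tD FGt; apply: tD.
apply/eqP/negP => /negP st; apply: FGt; congr EFin; congr iterint.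
by apply/funext => s; exact: FG.
Qed.

(** * Trigonometric integrals *)

Lemma sin_int_pi (R : realType) (k : int) : sin (k%:~R * pi) = 0 :> R.
Proof.
have H n : sin (n%:R * pi) = 0 :> R.
  elim: n => [|n IH]; first by rewrite mul0r sin0.
  by rewrite -natr1 mulrDl mul1r sinD IH sinpi mulr0 mul0r addr0.
by case: k => n; rewrite ?NegzE ?mulrNz ?mulNr ?sinN; rewrite H ?oppr0.
Qed.

(** For [k] nonzero the antiderivative takes equal values at both ends, since [sin (k * pi) = 0].
    The phase [a] stands for the contribution of the other variables. *)
Lemma Rintegral_cos (R : realType) (a : R) (k : int) :
  \int[@lebesgue_measure R]_(t in `[- pi, pi]%classic) cos (a + t * k%:~R) =
  (k == 0)%:R * (2 * pi * cos a).
Proof.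
have [->|k0] := eqVneq k 0.
  under eq_Rintegral do rewrite mulr0z mulr0 addr0.
  by rewrite Rintegral_cst//= lebesgue_measure_pi /=; ring.
rewrite mul0r.
have k0' : (k%:~R : R) != 0 by rewrite intr_eq0.
pose F (t : R) := k%:~R^-1 * sin (a + t * k%:~R).
have dF (t : R) : is_derive t (1 : R) F (cos (a + t * k%:~R)).
  rewrite /F; apply: is_derive_eq.
  by rewrite /GRing.scale /=; field.
have cf : continuous (fun t : R => cos (a + t * k%:~R)).
  move=> t; apply: continuous_comp; last exact: continuous_cos.
  by apply: cvgD; [exact: cvg_cst | apply: cvgMl; exact: cvg_id].
rewrite /Rintegral (@continuous_FTC2 _ _ F) //=.
- rewrite /F mulrC ![in LHS](mulrC pi) mulNr (mulrC pi) sinD sinB sin_int_pi.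
  by ring.
- by rewrite gtrN// pi_gt0.
- exact: continuous_subspaceT.
- have cF : continuous F.
    move=> t; apply: differentiable_continuous.
    by apply/derivable1_diffP; case: (dF t).
  split.
  + by move=> t _; case: (dF t).
  + apply: cvg_at_right_filter; exact: cF.
  + apply: cvg_at_left_filter; exact: cF.
- by move=> t _; rewrite derive1E; apply: derive_val.
Qed.

(** Orthogonality of characters on the torus. The free phase [a] carries the induction: the outer
    variable is absorbed into it while the frequencies shift by one. *)
Lemma iterint_cos (R : realType) n (m : nat -> int) (a : R) :
  iterint n (fun s => cos (a + \sum_(i < n) nth 0 s i * (m i)%:~R)) =
  [forall i : 'I_n, m i == 0]%:R * ((2 * pi) ^+ n * cos a).
Proof.
elim: n m a => [|n IH] m a /=.
  rewrite big_ord0 addr0 expr0 mul1r.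
  by case: forallP => [_|[]]; [rewrite mul1r | case].
have e (t : R) : iterint n (fun s =>
    cos (a + \sum_(i < n.+1) nth 0 (t :: s) i * (m i)%:~R)) =
    [forall i : 'I_n, m i.+1 == 0]%:R * (2 * pi) ^+ n * cos (a + t * (m 0%N)%:~R).
  rewrite -mulrA -(IH (fun i => m i.+1)).
  by congr iterint; apply/funext => s; rewrite big_ord_recl /= addrA.
under eq_Rintegral do rewrite e.
rewrite RintegralZl//; last first.
  apply: (bounded_measurable_integrable _ _ 1); last by move=> t; exact: cos_max.
  apply: continuous_measurable_fun => t.
  apply: continuous_comp; last exact: continuous_cos.
  by apply: cvgD; [exact: cvg_cst | apply: cvgMl; exact: cvg_id].
rewrite Rintegral_cos.
have -> : [forall i : 'I_n.+1, m i == 0] =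
    (m 0%N == 0) && [forall i : 'I_n, m i.+1 == 0].
  apply/forallP/andP => [H|[m0 /forallP H] i].
    by split; [exact: (H ord0) | apply/forallP => i; exact: (H (lift ord0 i))].
  by case: (unliftP ord0 i) => [j|] -> //; exact: (H j).
by rewrite -mulnb natrM exprS; ring.
Qed.

(** Induction on [|k|] by the addition formula, with cosines bounded by 1. *)
Lemma abs_sin_int (R : realType) (u : R) (k : int) :
  `|sin (u * k%:~R)| <= `|k|%:~R * `|sin u|.
Proof.
have H n : `|sin (u * n%:R)| <= n%:R * `|sin u|.
  elim: n => [|n IH]; first by rewrite mulr0 sin0 normr0 mul0r.
  rewrite -natr1 mulrDr mulr1 sinD mulrDl mul1r.
  rewrite (le_trans (ler_normD _ _))// lerD// normrM.
    by rewrite (le_trans _ IH)// ler_piMr// cos_max.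
  by rewrite ler_piMl// cos_max.
case: k => n; first exact: H.
by rewrite NegzE normrN mulrNz mulrN sinN normrN; exact: H.
Qed.

Lemma abs_sin_sum (R : realType) (I : Type) (r : seq I) (u : I -> R) (m : I -> int) :
  `|sin (\sum_(i <- r) u i * (m i)%:~R)| <= \sum_(i <- r) `|m i|%:~R * `|sin (u i)|.
Proof.
elim: r => [|i r IH]; first by rewrite !big_nil sin0 normr0.
rewrite !big_cons sinD (le_trans (ler_normD _ _))// lerD// normrM.
  by rewrite (le_trans _ (abs_sin_int _ _ _))// ler_piMr// cos_max.
by rewrite (le_trans _ IH)// ler_piMl// cos_max.
Qed.

(** * The fundamental solution *)

Lemma measurable_seq_comp (R : realType) n (f : R -> R) (F : seq R -> R) :
  continuous f -> measurable_seq R n F -> measurable_seq R n (fun s => f (F s)).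
Proof.
move=> cf mF d T c sc mc.
exact: measurableT_comp (continuous_measurable_fun cf) (mF d T c sc mc).
Qed.

Lemma measurable_seqM (R : realType) n (F G : seq R -> R) :
  measurable_seq R n F -> measurable_seq R n G ->
  measurable_seq R n (fun s => F s * G s).
Proof. by move=> mF mG d T c sc mc; apply: measurable_funM; [exact: mF | exact: mG]. Qed.

Lemma measurable_seq_sin_nth (R : realType) n i :
  measurable_seq R n (fun s => sin (nth 0 s i)).
Proof.
by apply: measurable_seq_comp => [|d T c _ mc]; [exact: continuous_sin | exact: mc].
Qed.

Section FundamentalSolution.
Variable R : realType.
Implicit Types (m : pt) (s : seq R) (c l : 'I_8).

Definition sin2sum s : R := \sum_(l < 8) sin (nth 0 s l) ^+ 2.
Definition phase m s : R := \sum_(l < 8) nth 0 s l * (m ord0 l)%:~R.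

(** Coordinate [c] of the integrand of [E1], stripped of its conjugation sign. *)
Definition E1fun m c s : R := (sin2sum s)^-1 * sin (phase m s) * sin (nth 0 s c).
(** Half the central difference of [E1fun] in direction [l], because [sin (p + u) - sin (p - u) = 2
    cos p sin u]. *)
Definition dE1fun m c l s : R :=
  (sin2sum s)^-1 * cos (phase m s) * (sin (nth 0 s c) * sin (nth 0 s l)).

Definition conj_sign c : R := if nat_of_ord c == 0%N then 1 else -1.

Lemma oconj_obasisE l c : oconj (obasis R l) ord0 c = conj_sign c * (c == l)%:R.
Proof. by rewrite /conj_sign !mxE; case: (_ == 0%N); rewrite ?mul1r ?mulN1r. Qed.

Lemma sin2sum_ge0 s : 0 <= sin2sum s.
Proof. by apply: sumr_ge0 => l _; exact: sqr_ge0. Qed.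

(** The product of two moduli is at most half the sum of their squares, and each square is at most
    [sin2sum s]. Where [sin2sum s] vanishes, its inverse is 0 by convention. *)
Lemma sin2sum_bound s c l :
  (sin2sum s)^-1 * (`|sin (nth 0 s c)| * `|sin (nth 0 s l)|) <= 1.
Proof.
have [q0|q0] := eqVneq (sin2sum s) 0; first by rewrite q0 invr0 mul0r.
have qp : 0 < sin2sum s by rewrite lt_def q0 sin2sum_ge0.
rewrite mulrC ler_pdivrMr// mul1r.
have b (k : 'I_8) : `|sin (nth 0 s k)| ^+ 2 <= sin2sum s.
  rewrite real_normK ?num_real// /sin2sum (bigD1 k)//= lerDl.
  by apply: sumr_ge0 => i _; exact: sqr_ge0.
have := b c; have := b l.
move: `|_| `|_| => x y hx hy.
have : 0 <= (x - y) ^+ 2 by exact: sqr_ge0.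
by rewrite sqrrB; lra.
Qed.

Lemma measurable_sin2sumV : measurable_seq R 8 (fun s => (sin2sum s)^-1).
Proof.
move=> d T c sc mc.
(* Inversion is not continuous at 0, but on nonnegative reals it is the power of exponent -1, which
   is measurable there too. *)
have -> : (fun s => (sin2sum s)^-1) \o c = (@powR R ^~ (-1)) \o (sin2sum \o c).
  by apply/funext => p /=; rewrite powR_inv1// sin2sum_ge0.
apply: measurableT_comp; first exact: measurable_powR.
apply: measurable_sum => l; apply: measurable_funX.
exact: measurable_seq_sin_nth.
Qed.

Lemma measurable_phase m : measurable_seq R 8 (phase m).
Proof.
move=> d T c sc mc; apply: measurable_sum => l; exact: measurable_funM.
Qed.

Lemma tame_E1fun m c : tame_seq R 8 (E1fun m c).
Proof.
split.
  apply: measurable_seqM; last exact: measurable_seq_sin_nth.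
  apply: measurable_seqM; first exact: measurable_sin2sumV.
  by apply: measurable_seq_comp; [exact: continuous_sin | exact: measurable_phase].
(* By [abs_sin_sum] the numerator is dominated by terms [|m_l| |sin u_l| |sin u_c|]; dividing each
   by [sin2sum s] leaves at most [|m_l|]. *)
exists (\sum_(l < 8) `|m ord0 l|%:~R) => s.
rewrite /E1fun !normrM normfV (ger0_norm (sin2sum_ge0 s)).
rewrite -mulrA mulrCA (le_trans (ler_wpM2r _ (abs_sin_sum _ _ _ _ _)))//.
  by rewrite mulr_ge0// invr_ge0 sin2sum_ge0.
rewrite mulr_suml; apply: ler_sum => l _.
rewrite -mulrA ler_piMr ?ler0z// mulrCA (mulrC `|sin (nth 0 s l)|).
exact: sin2sum_bound.
Qed.

Lemma tame_dE1fun m c l : tame_seq R 8 (dE1fun m c l).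
Proof.
split.
  apply: measurable_seqM; last by apply: measurable_seqM; exact: measurable_seq_sin_nth.
  apply: measurable_seqM; first exact: measurable_sin2sumV.
  by apply: measurable_seq_comp; [exact: continuous_cos | exact: measurable_phase].
exists 1 => s.
rewrite /dE1fun !normrM normfV (ger0_norm (sin2sum_ge0 s)) mulrAC.
apply: le_trans (sin2sum_bound s c l); rewrite ler_piMr ?cos_max//.
by rewrite mulr_ge0// ?invr_ge0 ?sin2sum_ge0// mulr_ge0.
Qed.

Lemma phaseD m l s : phase (m + ptbasis l) s = phase m s + nth 0 s l.
Proof.
rewrite /phase; under eq_bigr do rewrite !mxE intrD mulrDr.
rewrite big_split /=; congr (_ + _).
rewrite (bigD1 l)//= big1 ?addr0 => [|i il]; first by rewrite eqxx mulr1.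
by rewrite (negbTE il) mulr0z mulr0.
Qed.

Lemma phaseB m l s : phase (m - ptbasis l) s = phase m s - nth 0 s l.
Proof. by rewrite -[in RHS](subrK (ptbasis l) m) phaseD addrK. Qed.

Lemma iterint_E1fun_diff m c l :
  iterint 8 (E1fun (m + ptbasis l) c) - iterint 8 (E1fun (m - ptbasis l) c) =
  2 * iterint 8 (dE1fun m c l).
Proof.
rewrite -mulN1r -!iterintZ -?iterintD; do ?exact: tame_seqZ; do ?exact: tame_E1fun;
  do ?exact: tame_dE1fun; last by apply: tame_seqZ; exact: tame_E1fun.
congr iterint; apply/funext => s.
by rewrite /E1fun /dE1fun phaseD phaseB sinD sinB; ring.
Qed.

Lemma iterint_dE1fun_sym m c l : iterint 8 (dE1fun m c l) = iterint 8 (dE1fun m l c).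
Proof. by congr iterint; apply/funext => s; rewrite /dE1fun [sin _ * sin _]mulrC. Qed.

(* The diagonal symbols add up to [cos (u.m)] off the zeros of [sin u_0]. *)
Lemma iterint_dE1fun_trace m :
  \sum_(l < 8) iterint 8 (dE1fun m l l) = (m == 0)%:R * (2 * pi) ^+ 8.
Proof.
rewrite -iterint_sum; last by move=> l; exact: tame_dE1fun.
(* [iterint_cos] takes frequencies indexed by naturals; only the values at indices below 8
   matter. *)
pose mm (i : nat) : int := m ord0 (inord i).
have -> : iterint 8 (fun s => \sum_(l < 8) dE1fun m l l s) =
    iterint 8 (fun s => cos (0 + \sum_(i < 8) nth 0 s i * (mm i)%:~R)).
  have e s : phase m s = 0 + \sum_(i < 8) nth 0 s i * (mm i)%:~R.
    by rewrite add0r; apply: eq_bigr => i _; rewrite /mm inord_val.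
  apply: iterint_eq_off_sin0.
  - by apply: tame_seq_sum => l; exact: tame_dE1fun.
  - split; last by exists 1 => s; exact: cos_max.
    rewrite -(_ : (fun s => cos (phase m s)) =
                  (fun s => cos (0 + \sum_(i < 8) nth 0 s i * (mm i)%:~R))).
      by apply: measurable_seq_comp; [exact: continuous_cos | exact: measurable_phase].
    by apply/funext => s; rewrite e.
  - move=> t s st; rewrite -e /dE1fun.
    under eq_bigr do rewrite -expr2.
    rewrite -mulr_sumr -/(sin2sum (t :: s)) mulrAC mulVf ?mul1r//.
    rewrite gt_eqF// /sin2sum big_ord_recl /= ltr_wpDr ?exprn_even_gt0//.
    by apply: sumr_ge0 => i _; exact: sqr_ge0.
rewrite iterint_cos cos0 mulr1; congr ((nat_of_bool _)%:R * _).
apply/forallP/eqP => [H|m0 i]; last by rewrite /mm m0 mxE.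
apply/rowP => i; rewrite mxE; have := H i; rewrite /mm inord_val => /eqP; exact.
Qed.

Lemma E1_coord m c :
  E1 R m ord0 c = (2 * pi) ^- 8 * (conj_sign c * iterint 8 (E1fun m c)).
Proof.
rewrite mxE; congr (_ * _); rewrite -iterintZ; last exact: tame_E1fun.
congr iterint; apply/funext => s.
rewrite /E1integrand mxE summxE [X in _ * X = _](eq_bigr (fun l => sin (nth 0 s l) *
  (conj_sign c * (c == l)%:R))) => [|l _]; last by rewrite mxE oconj_obasisE.
rewrite [X in _ * X = _](bigD1 c)//= [X in _ * (_ + X) = _]big1 => [|i ic].
  by rewrite eqxx mulr1 addr0 /E1fun /phase /sin2sum; ring.
by rewrite eq_sym (negbTE ic) !mulr0.
Qed.

(** Up to [conj_sign c], coordinate [c] of the central difference quotient of [E1] in direction [l]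
    at unit spacing. *)
Definition dE1 m c l : R := (2 * pi) ^- 8 * iterint 8 (dE1fun m c l).

Lemma dE1_sym m c l : dE1 m c l = dE1 m l c.
Proof. by rewrite /dE1 iterint_dE1fun_sym. Qed.

Lemma dE1_trace m : \sum_(l < 8) dE1 m l l = (m == 0)%:R.
Proof.
rewrite -mulr_sumr iterint_dE1fun_trace mulrCA mulVf ?mulr1//.
by rewrite expf_neq0// mulf_neq0// ?pnatr_eq0// gt_eqF// pi_gt0.
Qed.

Lemma E1_diff m l :
  E1 R (m + ptbasis l) - E1 R (m - ptbasis l) =
  2 *: \row_c (conj_sign c * dE1 m c l).
Proof.
have := E1_coord (m + ptbasis l); have := E1_coord (m - ptbasis l).
move: (E1 R _) (E1 R _) => a b aE bE; apply/rowP => c.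
rewrite !mxE aE bE.
by rewrite -!mulrBr iterint_E1fun_diff /dE1; ring.
Qed.

End FundamentalSolution.

(** * Octonion algebra *)

Section Octonions.
Variable R : realType.
Implicit Types (a b g : oct R) (c l : 'I_8).

(** Octonion structure constants over integers and natural indices, so that identities among them
    can be evaluated. *)
Definition bmul_coef (i j k : nat) : int :=
  if i == 0%N then (k == j)%:R
  else if j == 0%N then (k == i)%:R
  else (if k == 0%N then - (i == j)%:R else 0) + eps i j k.

Lemma bmulE (i j k : 'I_8) : bmul R i j ord0 k = (bmul_coef i j k)%:~R.
Proof.
rewrite /bmul /bmul_coef; case: ifP => _; first by rewrite !mxE natz.
case: ifP => _; first by rewrite !mxE natz.
rewrite !mxE summxE (bigD1 k)//= big1 ?addr0 => [|q qk].
  rewrite !mxE eqxx mulr1 intrD; congr (_ + _).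
  rewrite -[k == ord0]/(nat_of_ord k == 0%N) -[i == j]/(nat_of_ord i == nat_of_ord j).
  by case: (nat_of_ord k == 0%N); rewrite ?mulr1 ?mulr0// mulrNz; case: (_ == _).
by rewrite !mxE eq_sym (negbTE qk) mulr0.
Qed.

Lemma omulE a b (k : 'I_8) :
  omul a b ord0 k =
  \sum_(i < 8) \sum_(j < 8) a ord0 i * b ord0 j * (bmul_coef i j k)%:~R.
Proof.
rewrite summxE; apply: eq_bigr => i _; rewrite summxE; apply: eq_bigr => j _.
by rewrite mxE bmulE.
Qed.

Lemma omul_linearl b k a a' : omul (k *: a + a') b = k *: omul a b + omul a' b.
Proof.
rewrite /omul scaler_sumr -big_split /=; apply: eq_bigr => i _.
rewrite scaler_sumr -big_split /=; apply: eq_bigr => j _.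
by rewrite !mxE scalerA -scalerDl mulrDl mulrA.
Qed.

Lemma omul_linearr a k b b' : omul a (k *: b + b') = k *: omul a b + omul a b'.
Proof.
rewrite /omul scaler_sumr -big_split /=; apply: eq_bigr => i _.
rewrite scaler_sumr -big_split /=; apply: eq_bigr => j _.
by rewrite !mxE scalerA -scalerDl mulrDr mulrCA.
Qed.

HB.instance Definition _ a :=
  GRing.isLinear.Build R (oct R) (oct R) *:%R (omul a) (omul_linearr a).
Definition omulr b a : oct R := omul a b.
HB.instance Definition _ b :=
  GRing.isLinear.Build R (oct R) (oct R) *:%R (omulr b) (omul_linearl b).

(** It acts on row vectors from the right, so that [e_c (e_l g)] is [g] times the matrix of [l] and
    then that of [c]. *)
Definition left_mul_mx (c : nat) : 'M[int]_8 := \matrix_(j, k) bmul_coef c j k.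

Lemma omul_obasisl c g :
  omul (obasis R c) g = g *m map_mx intr (left_mul_mx c).
Proof.
apply/rowP => k; rewrite omulE mxE (bigD1 c)//= [X in _ + X]big1 ?addr0 => [|i ic].
  by apply: eq_bigr => j _; rewrite !mxE eqxx mul1r.
by apply: big1 => j _; rewrite mxE (negbTE ic) !mul0r.
Qed.

Let sign (c : nat) : int := if c == 0%N then 1 else -1.

(** Entry [(j, p)] of the matrix form of [omul_clifford]. *)
Lemma bmul_coef_clifford c l (j p : 'I_8) :
  sign c * (\sum_(q < 8) bmul_coef l j q * bmul_coef c q p)
  + sign l * (\sum_(q < 8) bmul_coef c j q * bmul_coef l q p)
  = if (c == l) && (j == p) then 2 else 0.
Proof.
(* The sums are rephrased as folds that reduce, and all [8^4] index quadruples are then checked by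
   evaluation. *)
pose sum8 (F : nat -> int) := foldr (fun q s => F q + s) 0 (iota 0 8).
pose check (c l j p : nat) :=
  sign c * sum8 (fun q => bmul_coef l j q * bmul_coef c q p)
  + sign l * sum8 (fun q => bmul_coef c j q * bmul_coef l q p)
  == if (c == l) && (j == p) then 2 else 0.
have sum8E F : \sum_(q < 8) F (nat_of_ord q) = sum8 F.
  by rewrite -(big_mkord xpredT) unlock.
rewrite (sum8E (fun q => bmul_coef l j q * bmul_coef c q p)).
rewrite (sum8E (fun q => bmul_coef c j q * bmul_coef l q p)).
have : all (fun x => all (fun y => all (fun z => all (check x y z)
  (iota 0 8)) (iota 0 8)) (iota 0 8)) (iota 0 8) by vm_compute.
have io (i : 'I_8) : nat_of_ord i \in iota 0 8 by rewrite mem_iota ltn_ord.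
by move=> /allP/(_ _ (io c))/allP/(_ _ (io l))/allP/(_ _ (io j))/allP/(_ _ (io p))/eqP.
Qed.

(** Both sides are linear in [g], so it suffices to compare products of left multiplication
    matrices. *)
Lemma omul_clifford c l g :
  conj_sign R c *: omul (obasis R c) (omul (obasis R l) g)
  + conj_sign R l *: omul (obasis R l) (omul (obasis R c) g)
  = (2 * (c == l)%:R) *: g.
Proof.
have signE i : conj_sign R i = (sign i)%:~R by rewrite /conj_sign /sign; case: ifP.
rewrite !omul_obasisl -!mulmxA -!map_mxM !signE !scalemxAr -mulmxDr.
set M := _ + _; suff -> : M = (2 * (c == l)%:R)%:M by rewrite mul_mx_scalar.
apply/matrixP => j p; rewrite /M !mxE -!intrM -intrD.
under eq_bigr do rewrite !mxE.
under [X in _ + _ * X]eq_bigr do rewrite !mxE.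
rewrite bmul_coef_clifford; case: (c == l); case: (j == p) => //=;
  by rewrite ?mulr0n ?mulr1 ?mulr0.
Qed.

(** Twice the double sum is the sum plus its copy with [c] and [l] exchanged. By symmetry of [A] the
    Clifford relation applies to each pair, kills the off-diagonal ones and doubles the diagonal. *)
Lemma omul_sym_sum (A : 'I_8 -> 'I_8 -> R) g : (forall c l, A c l = A l c) ->
  \sum_(l < 8) omul (\row_c (conj_sign R c * A c l)) (omul (obasis R l) g)
  = (\sum_(l < 8) A l l) *: g.
Proof.
move=> Asym.
pose P c l := A c l *: (conj_sign R c *: omul (obasis R c) (omul (obasis R l) g)).
have -> : \sum_(l < 8) omul (\row_c (conj_sign R c * A c l)) (omul (obasis R l) g)
    = \sum_(l < 8) \sum_(c < 8) P c l.
  apply: eq_bigr => l _; set b := omul _ g.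
  have -> : \row_c (conj_sign R c * A c l) =
      \sum_(c < 8) (A c l * conj_sign R c) *: obasis R c.
    apply/rowP => c; rewrite summxE (bigD1 c)//= big1 ?addr0 => [|i ic].
      by rewrite !mxE eqxx mulr1 mulrC.
    by rewrite !mxE eq_sym (negbTE ic) mulr0.
  rewrite -/(omulr b _) linear_sum /=; apply: eq_bigr => c _.
  by rewrite linearZ /= /P scalerA.
apply: (scalerI (_ : (2 : R) != 0)); first by rewrite pnatr_eq0.
rewrite scaler_nat mulr2n {2}exchange_big -big_split /=.
rewrite scalerA mulr_sumr scaler_suml; apply: eq_bigr => l _.
rewrite -big_split /= (bigD1 l)//= big1 ?addr0 => [|c cl].
  by rewrite /P -scalerDr omul_clifford eqxx mulr1 scalerA mulrC.
by rewrite /P (Asym l c) -scalerDr omul_clifford (negbTE cl) mulr0 scale0r scaler0.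
Qed.

End Octonions.

(** * Summation by parts *)

(** The set [S] lets sums with different shifts [v] share one range, the domain being recorded by
    the translated indicator. *)
Lemma fsbig_shift (R : realType) (V : lmodType R) (B S : set pt) (v : pt) (F : pt -> V) :
  (forall x, B (x + v) -> S x) ->
  \sum_(x \in B) F x = \sum_(x \in S) (\1_B (x + v) : R) *: F (x + v).
Proof.
move=> BS.
rewrite (@reindex_fsbig _ _ _ _ _ (fun x => x + v) [set x | B (x + v)] B); last first.
  split => [x //||x Bx /=]; first by move=> x z _ _; exact: addIr.
  by exists (x - v); rewrite /= subrK.
rewrite -(@fsbig_widen _ _ _ _ [set x | B (x + v)] S) //=.
  apply: eq_fsbigr => x; rewrite inE /= => Bx.
  by rewrite indicE mem_set// scale1r.
by move=> x [_ /= nB]; rewrite indicE memNset// scale0r.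
Qed.

Lemma finite_int_box (n : nat) :
  finite_set [set k : pt | forall i : 'I_8, `|k ord0 i| <= n%:Z].
Proof.
(* Each coordinate takes [2n + 1] values; subtracting [n] centres them at 0. *)
pose g (v : 'rV['I_(n + n).+1]_8) : pt := \row_i ((v ord0 i)%:Z - n%:Z).
apply: (@sub_finite_set _ _ (g @` setT)); last exact/finite_image/finite_finset.
move=> k /= kn; exists (\row_i inord (absz (k ord0 i + n%:Z))) => //.
apply/rowP => i; rewrite !mxE; have := kn i; rewrite ler_norml => /andP[k1 k2].
rewrite inordK; first by rewrite gez0_abs ?addrK// -lerBlDr sub0r.
rewrite ltnS -lez_nat gez0_abs; last by rewrite -lerBlDr sub0r.
by rewrite PoszD lerD2r.
Qed.

Section BoundaryTerm.
Variables (R : realType) (h : R) (B : set pt).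

Lemma Sigma_eq0 x l : Sigma h B x = 0 -> dchiP h B l x = 0 /\ dchiM h B l x = 0.
Proof.
move=> /eqP; rewrite psumr_eq0 => [/allP/(_ l)|i _]; last first.
  by rewrite addr_ge0 ?sqr_ge0.
rewrite mem_index_enum => /(_ isT); rewrite paddr_eq0 ?sqr_ge0// !sqrf_eq0.
by case/andP => /eqP -> /eqP ->.
Qed.

(** The root in the surface weight cancels the one normalising the normals. Where it vanishes, so
    does the difference [d], and both sides are 0. *)
Lemma sqrt_Sigma_cancel x d : (Sigma h B x = 0 -> d = 0) ->
  Num.sqrt (Sigma h B x) * (- 2 * d / Num.sqrt (Sigma h B x)) = - 2 * d.
Proof.
have Sge0 : 0 <= Sigma h B x.
  by apply: sumr_ge0 => l _; rewrite addr_ge0 ?sqr_ge0.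
have [S0 -> //|S0 _] := eqVneq (Sigma h B x) 0; first by rewrite mulr0 mul0r mulr0.
by rewrite mulrC divfK// sqrtr_eq0 -ltNge lt_def S0.
Qed.

(** The spacing drops out: [h^8] from the weight, [h^-7] from [Eh] and [1/h] from the normal
    multiply to 1, and the constants to 1/2. *)
Lemma sdS_Kstar x y (f : pt -> oct R) : 0 < h ->
  sdS h B x *: Kstar h B x y f =
  2^-1 *: \sum_(l < 8)
    ((\1_B x - \1_B (x - ptbasis l)) *:
       omul (E1 R (y - x + ptbasis l)) (omul (obasis R l) (f x))
   + (\1_B (x + ptbasis l) - \1_B x) *:
       omul (E1 R (y - x - ptbasis l)) (omul (obasis R l) (f x))).
Proof.
move=> h0; rewrite /Kstar /Eh; move: (E1 R) => E.
rewrite scalerA !scaler_sumr; apply: eq_bigr => l _.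
rewrite (addrC (y - x)) (addrC (y - x) (- _)) !addrA [ptbasis l + y]addrC.
have -> : ptbasis l - x + y = y + ptbasis l - x by rewrite addrAC [ptbasis l + y]addrC.
have -> : - ptbasis l - x + y = - ptbasis l + y - x by rewrite addrAC.
move: (omul _ (f x)) => w.
rewrite -!/(omulr R w _) linearD /= !scalerA !linearZ /= !scalerDr !scalerA.
have h0' : h != 0 by rewrite gt_eqF.
congr (_ *: _ + _ *: _).
  transitivity (- (h ^+ 8 / 2 / 2 * h ^- 7) * (Num.sqrt (Sigma h B x) * nM h B l x)).
    by rewrite /sdS; ring.
  rewrite sqrt_Sigma_cancel; last by move=> /Sigma_eq0 -/(_ l)[].
  by rewrite /dchiM; field.
transitivity (- (h ^+ 8 / 2 / 2 * h ^- 7) * (Num.sqrt (Sigma h B x) * nP h B l x)).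
  by rewrite /sdS; ring.
rewrite sqrt_Sigma_cancel; last by move=> /Sigma_eq0 -/(_ l)[].
by rewrite /dchiP; field.
Qed.

(** The one-sided quotients add up to a central one, in which [f x] cancels; the powers of [h] again
    multiply to 1. *)
Lemma omul_Eh_Dh x y (f : pt -> oct R) : 0 < h ->
  h ^+ 8 *: omul (Eh h (y - x)) (Dh h f x) =
  2^-1 *: \sum_(l < 8)
    (omul (E1 R (y - x)) (omul (obasis R l) (f (x + ptbasis l)))
   - omul (E1 R (y - x)) (omul (obasis R l) (f (x - ptbasis l)))).
Proof.
move=> h0; rewrite /Eh /Dh; move: (E1 R) => E.
rewrite [omul _ (\sum_(l < 8) _)]linear_sum /= !scaler_sumr; apply: eq_bigr => l _.
have -> : 2^-1 *: (h^-1 *: (f (x + ptbasis l) - f x) +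
    h^-1 *: (f x - f (x - ptbasis l))) =
    (2^-1 / h) *: (f (x + ptbasis l) - f (x - ptbasis l)).
  by rewrite -scalerDr scalerA addrA subrK.
rewrite -[omul (_ *: _) _]/(omulr R _ _) linearZ /= /omulr !linearZ !linearB /= !scalerA.
have h0' : h != 0 by rewrite gt_eqF.
by rewrite scalerBr !scalerA; congr (_ *: _ - _ *: _); field.
Qed.

(** Since [x] belongs to its own neighbourhood, a neighbour on the other side of [B] would put [x]
    in [bdry B]. *)
Lemma indic_jump_outside_bdry x l : ~ bdry B x ->
  \1_B (x + ptbasis l) = \1_B x :> R /\ \1_B (x - ptbasis l) = \1_B x :> R.
Proof.
move=> nb.
have nx : nbhd x x by left.
have np : nbhd x (x + ptbasis l) by right; exists l; left.
have nm : nbhd x (x - ptbasis l) by right; exists l; right.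
have e z : nbhd x z -> \1_B z = \1_B x :> R.
  move=> nz; rewrite !indicE; have [Bz|Bz] := pselect (B z).
    have [Bx|Bx] := pselect (B x); first by rewrite !mem_set.
    by exfalso; apply: nb; split; [exists z | exists x].
  have [Bx|Bx] := pselect (B x); last by rewrite !memNset.
  by exfalso; apply: nb; split; [exists x | exists z].
by split; exact: e.
Qed.

End BoundaryTerm.

(** This set contains both [B] and [bdry B], and serves as the common finite range of summation. *)
Lemma finite_nbhd_int_box (B : set pt) :
  (exists M : int, forall k : pt, B k -> forall i : 'I_8, `|k ord0 i| <= M) ->
  finite_set [set x | exists2 z, nbhd x z & B z].
Proof.
(* Passing to a neighbour changes each coordinate by at most 1. *)
move=> [M BM]; apply: sub_finite_set (finite_int_box (absz M + 1)).
have pb (l i : 'I_8) : `|(i == l)%:R : int| <= 1 by case: (_ == _).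
have MM : M <= (absz M)%:Z by rewrite abszE ler_norm.
move=> x [z xz Bz] i; rewrite PoszD.
have {Bz}zM : `|z ord0 i| <= (absz M)%:Z by exact: le_trans (BM z Bz i) MM.
case: xz => [zx|[l [zx|zx]]].
- by rewrite -zx (le_trans zM)// lerDl.
- have -> : x = z - ptbasis l by rewrite zx addrK.
  by rewrite !mxE (le_trans (ler_normB _ _))// lerD.
- have -> : x = z + ptbasis l by rewrite zx subrK.
  by rewrite !mxE (le_trans (ler_normD _ _))// lerD.
Qed.

(** The kernel [E] is abstract because it enters only through its central differences. *)
Lemma summation_by_parts (R : realType) (B : set pt) (f : pt -> oct R) (y : pt)
    (E : pt -> oct R) :
  (forall m l, E (m + ptbasis l) - E (m - ptbasis l) =
     2 *: \row_c (conj_sign R c * dE1 R m c l)) ->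
  finite_set [set x | exists2 z, nbhd x z & B z] ->
  \1_B y *: f y =
    \sum_(x \in bdry B) 2^-1 *: \sum_(l < 8)
      ((\1_B x - \1_B (x - ptbasis l)) *:
         omul (E (y - x + ptbasis l)) (omul (obasis R l) (f x))
     + (\1_B (x + ptbasis l) - \1_B x) *:
         omul (E (y - x - ptbasis l)) (omul (obasis R l) (f x)))
    + \sum_(x \in B) 2^-1 *: \sum_(l < 8)
      (omul (E (y - x)) (omul (obasis R l) (f (x + ptbasis l)))
     - omul (E (y - x)) (omul (obasis R l) (f (x - ptbasis l)))).
Proof.
move=> dT; set S := [set x | _] => fS.
have BS : B `<=` S by move=> x Bx; exists x => //; left.
set T := fun x => 2^-1 *: _; set U := fun x => 2^-1 *: _.
pose G l x v := omul (E (y - x + v)) (omul (obasis R l) (f x)).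
(* Off the boundary the jumps of the indicator are 0, so the sum extends to [S]. *)
have -> : \sum_(x \in bdry B) T x =
    2^-1 *: \sum_(l < 8) \sum_(x <- finmap.enum_fset (fset_set S))
      ((\1_B x - \1_B (x - ptbasis l)) *: G l x (ptbasis l)
     + (\1_B (x + ptbasis l) - \1_B x) *: G l x (- ptbasis l)).
  rewrite (@fsbig_widen _ _ _ _ (bdry B) S); last 2 first.
  - by move=> x [].
  - move=> x [_ nx] /=; rewrite /T big1 ?scaler0// => l _.
    by have [-> ->] := indic_jump_outside_bdry R B x l nx; rewrite subrr !scale0r addr0.
  by rewrite fsbig_finite//= exchange_big scaler_sumr; apply: eq_bigr.
(* Translating by [ptbasis l] either way brings [f] back to [x] and moves the shift onto [E] and the
   indicator. *)
have -> : \sum_(x \in B) U x =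
    2^-1 *: \sum_(l < 8) \sum_(x <- finmap.enum_fset (fset_set S))
      ((\1_B (x - ptbasis l) : R) *: G l x (ptbasis l)
     - (\1_B (x + ptbasis l) : R) *: G l x (- ptbasis l)).
  have fB : finite_set B by exact: sub_finite_set fS.
  rewrite (eq_fsbigr (fun x => 2^-1 *: \sum_(l < 8)
      (G l (x + ptbasis l) (ptbasis l) - G l (x - ptbasis l) (- ptbasis l)))); last first.
    move=> x _; rewrite /U; congr (_ *: _); apply: eq_bigr => l _.
    by rewrite /G opprD opprB !addrA addrNK addrAC addrK.
  rewrite fsbig_finite//= -scaler_sumr exchange_big /=; congr (_ *: _).
  apply: eq_bigr => l _; rewrite !sumrB -!(fsbig_finite _ _)//.
  congr (_ - _).
    rewrite (@fsbig_shift R _ B S (- ptbasis l)) => [|x Bx].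
      by apply: eq_fsbigr => x _; rewrite subrK.
    by exists (x - ptbasis l) => //; right; exists l; right.
  rewrite (@fsbig_shift R _ B S (ptbasis l)) => [|x Bx].
    by apply: eq_fsbigr => x _; rewrite addrK.
  by exists (x + ptbasis l) => //; right; exists l; left.
rewrite -scalerDr -big_split /=.
under eq_bigr do rewrite -big_split /=.
rewrite exchange_big scaler_sumr /=.
(* The shifted indicators cancel between the two sums. What remains is [\1_B x] times the central
   differences of [E], whose products with [e_l f(x)] sum to a delta at [x = y]. *)
rewrite (eq_bigr (fun x => (\1_B x * (y - x == 0)%:R) *: f x)) => [|x _]; last first.
  transitivity (2^-1 *: \sum_(l < 8) (\1_B x * 2 : R) *: omul
      (\row_c (conj_sign R c * dE1 R (y - x) c l)) (omul (obasis R l) (f x))).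
    congr (_ *: _); apply: eq_bigr => l _.
    transitivity ((\1_B x : R) *: (G l x (ptbasis l) - G l x (- ptbasis l))).
      rewrite !scalerBl scalerBr -[LHS]addrA.
      by rewrite [X in _ + X = _]addrC [X in _ + X = _]addrA subrK addrA subrK.
    rewrite -scalerA; congr (_ *: _); rewrite /G.
    set w := omul (obasis _ _) _.
    rewrite -![omul _ w]/(omulr R w _) -linearB dT linearZ /=; congr (_ *: _).
  rewrite -scaler_sumr omul_sym_sum; last exact: dE1_sym.
  by rewrite dE1_trace !scalerA; congr (_ *: _); field.
(* If [y] is in [B] it lies in [S] and the delta selects it; otherwise the indicator vanishes at the
   only point the delta could select. *)
have [By|nBy] := pselect (B y).
  rewrite -fsbig_finite// (fsbigD1 y)//=; last exact: BS.
  rewrite fsbig1 => [|x [_ /eqP xy]]; last by rewrite subr_eq0 eq_sym (negbTE xy) mulr0 scale0r.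
  by rewrite subrr eqxx mulr1 addr0.
rewrite [in LHS]indicE memNset// scale0r big1// => x _.
have [<-|yx] := eqVneq y x; first by rewrite indicE memNset// mul0r scale0r.
by rewrite subr_eq0 (negbTE yx) mulr0 scale0r.
Qed.

Theorem mainTheorem7 (R : realType) (h : R) (B : set pt) (f : pt -> oct R) (y : pt) :
  0 < h ->
  (exists M : int, forall k : pt, B k -> forall i : 'I_8, `|k ord0 i| <= M) ->
  \1_B y *: f y =
    \sum_(x \in bdry B) sdS h B x *: Kstar h B x y f
    + \sum_(x \in B) h ^+ 8 *: omul (Eh h (y - x)) (Dh h f x).
Proof.
move=> h0 /finite_nbhd_int_box fS.
have e := summation_by_parts R B f y (E1 R) (E1_diff R) fS.
rewrite e; congr (_ + _); apply: eq_fsbigr => x _; apply/esym.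
  exact: sdS_Kstar.
exact: omul_Eh_Dh.
Qed.
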